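(* For every $a,b\in\mathbb{R}$ with $0<a<b$ there exists a nonzero signed measure with integral $0$ (total mass zero), support contained in $[a,b]$ and $C^\infty$ density for which infinitely many moments vanish.
   Context: The density is with respect to Lebesgue measure and is a $C^\infty$ function $f:\mathbb{R}\to\mathbb{R}$ with support contained in $[a,b]$. For $k\in\mathbb{N}=\{0,1,2,\dots\}$ the $k$th moment of the signed measure with density $f$ is $\int_a^b f(x)x^k\,dx$. *)

(* Defs.v *)
From mathcomp Require Import all_boot all_order all_algebra.
From mathcomp Require Import all_classical all_reals all_analysis.

Set Implicit Arguments.
Unset Strict Implicit.
Unset Printing Implicit Defensive.

Import Order.TTheory GRing.Theory Num.Theory.
Import numFieldNormedType.Exports.

Local Open Scope classical_set_scope.
Local Open Scope ring_scope.

Definition smooth (R : realType) (f : R -> R) : Prop :=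
  forall (n : nat) (x : R), derivable (f^`(n))%classic x 1.

Definition fun_support (R : realType) (f : R -> R) : set R :=
  closure [set x | f x != 0].

Definition has_lebesgue_density (R : realType)
    (nu : {charge set (measurableTypeR R) -> \bar R}) (f : R -> R) : Prop :=
  (@lebesgue_measure R).-integrable [set: R] (EFin \o f) /\
  forall A : set (measurableTypeR R), measurable A ->
    nu A = (\int[@lebesgue_measure R]_(x in A) (f x)%:E)%E.

(* A charge is a function on all sets, but only its values on measurable sets
   are meaningful. *)
Definition nonzero_charge (R : realType)
    (nu : {charge set (measurableTypeR R) -> \bar R}) : Prop :=
  exists2 A : set (measurableTypeR R), measurable A & nu A != 0%E.

Definition moment (R : realType) (a b : R) (f : R -> R) (k : nat) : \bar R :=
  (\int[@lebesgue_measure R]_(x in `[a, b]) (f x * x ^+ k)%:E)%E.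

(* Main.v *)
Require Import Defs.
From mathcomp Require Import all_boot all_order all_algebra.
From mathcomp Require Import all_classical all_reals all_analysis.
From mathcomp Require Import ring lra.
Set Implicit Arguments.
Unset Strict Implicit.
Unset Printing Implicit Defensive.

Import Order.TTheory GRing.Theory Num.Theory.
Import numFieldNormedType.Exports.
Local Open Scope classical_set_scope.
Local Open Scope ring_scope.

(** Let D f = (x f)'. Integration by parts shows that, for f smooth with support
    in [a, b], the moment of order m of D f is - m times that of f. Hence
    f + k^-1 D f, k > 0, has as moment of order m the one of f multiplied by 1 - m / k:
    the operator 1 + k^-1 D kills the moment of order k and keeps all moments
    that were already zero ([moment_kill_moment]).

    Start with the derivative F 0 = g' of a smooth bump g supported in [a, b],
    whose integral vanishes, and apply the operators 1 + (k j)^-1 D one after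
    the other. Nothing enlarges the support. As D (F j) is a test function that
    does not depend on k j, choosing k j large enough makes its derivatives
    of order at most j, divided by k j, smaller than c / 2 ^ (j + 1)
    ([kill_moment_sequence]). So the infinite product converges with all
    derivatives to a smooth function f ([smooth_geometric_limit]). Its moments
    are the limits of those of F j, hence they vanish in order 0 and in every
    order k j ([moment_limit_eq0]); there are infinitely many of the latter since
    k j > j. Finally c is taken as half the size of F 0 at a point x0 where it
    is not zero, so that f x0 <> 0, and a continuous density that is not
    identically 0 does not define the zero charge
    ([nonzero_charge_continuous]).

    The bump is the usual product of translates of exp(-1/x); its smoothness comes
    from the stability under derivation of the family p(1/x) exp(-1/x), p a
    polynomial ([is_derive_flat]). *)

(** * Smooth functions *)

(** Differentiability as a linear approximation, without the quotient: this
    form has no singularity at h = 0 and passes to limits by plain estimates. *)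
Lemma is_derive_epsP (R : realType) (f : R -> R) (x l : R) :
  is_derive x 1 f l <-> forall e, 0 < e -> exists2 d, 0 < d &
    forall h, `|h| < d -> `|f (x + h) - f x - l * h| <= e * `|h|.
Proof.
have quotient h : h != 0 ->
    f (x + h) - f x - l * h = h * (h^-1 *: (f (h *: 1 + x) - f x) - l).
  by move=> h0; rewrite /GRing.scale/= mulr1 (addrC h x); field.
split=> [[df dfl] e e0|H].
  have : h^-1 *: (f (h *: 1 + x) - f x) @[h --> 0^'] --> l by rewrite -dfl.
  move=> /cvgrPdist_le/(_ e e0); rewrite near_withinE => /nbhs_ballP[d /= d0 Hd].
  exists d => // h hd; have [->|h0] := eqVneq h 0.
    by rewrite addr0 subrr mulr0 subrr normr0 mulr0.
  have := Hd h; rewrite /ball/= sub0r normrN => /(_ hd h0).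
  by rewrite quotient// normrM mulrC ler_pM2r ?normr_gt0// distrC.
have C : h^-1 *: (f (h *: 1 + x) - f x) @[h --> 0^'] --> l.
  apply/cvgrPdist_le => e e0; have [d d0 Hd] := H e e0.
  near=> h.
  have h0 : h != 0 by near: h; exact: nbhs_dnbhs_neq.
  have hd : `|h| < d by near: h; apply: dnbhs0_lt.
  have := Hd h hd.
  by rewrite quotient// normrM mulrC ler_pM2r ?normr_gt0// distrC.
apply: DeriveDef; first by apply/cvg_ex; exists l.
exact: cvg_lim C.
Unshelve. all: by end_near. Qed.

(** Smoothness by coinduction: a class of derivable functions stable under
    derivation contains only smooth functions. It saves computing iterated
    derivatives. *)
Lemma smooth_coind (R : realType) (S : (R -> R) -> Prop) :
  (forall f, S f -> (forall x : R, derivable f x 1) /\ S f^`()%classic) ->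
  forall f, S f -> smooth f.
Proof.
move=> HS f Sf n; suff: S f^`(n)%classic by move=> /HS[].
elim: n => [//|n ih]; rewrite derive1nS; exact: (HS _ ih).2.
Qed.

Lemma smooth_derivable (R : realType) (f : R -> R) : smooth f ->
  forall x : R, derivable f x 1.
Proof. by move=> /(_ 0%N). Qed.

Lemma smooth_derive1 (R : realType) (f : R -> R) : smooth f -> smooth f^`()%classic.
Proof. by move=> sf n; rewrite -derive1Sn; exact: sf n.+1. Qed.

Lemma derivable_continuous (R : realType) (f : R -> R) :
  (forall x : R, derivable f x 1) -> continuous f.
Proof. by move=> df x; apply/differentiable_continuous/derivable1_diffP. Qed.

Lemma is_derive1E (R : realType) (f : R -> R) (x l : R) :
  is_derive x 1 f l -> f^`()%classic x = l.
Proof. by move=> H; rewrite derive1E; exact: derive_val. Qed.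

Lemma derivable_is_derive1 (R : realType) (f : R -> R) (x : R) :
  derivable f x 1 -> is_derive x 1 f (f^`()%classic x).
Proof. by rewrite derive1E; exact: derivableP. Qed.

(** Leibniz and chain rules keep derivatives inside this closure of the smooth
    functions, so that coinduction applies to it and yields all the closure
    properties of smoothness at once. *)
Inductive smooth_gen (R : realType) : (R -> R) -> Prop :=
| SmoothBase f : smooth f -> smooth_gen f
| SmoothAdd f g : smooth_gen f -> smooth_gen g -> smooth_gen (f \+ g)
| SmoothMul f g : smooth_gen f -> smooth_gen g -> smooth_gen (f \* g)
| SmoothAffine f c d : smooth_gen f -> smooth_gen (fun x => f (c * x + d)).

Lemma is_derive_affine (R : realType) (f : R -> R) (c d x l : R) :
  is_derive (c * x + d) 1 f l -> is_derive x 1 (fun x => f (c * x + d)) (l * c).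
Proof.
move=> H; have G : is_derive x 1 (fun x => c * x + d) c.
  by apply: is_derive_eq; rewrite /GRing.scale/=; ring.
exact: (@is_derive1_comp R f (fun x => c * x + d) x l c H G).
Qed.

Lemma smooth_cst (R : realType) (c : R) : smooth (fun _ => c).
Proof.
apply: (@smooth_coind _ (fun f => exists c, f = fun _ => c)); last by exists c.
move=> f [{}c ->]; split; first by move=> x; exact: derivable_cst.
by exists 0; apply/funext => x; rewrite derive1_cst.
Qed.

Lemma smooth_id (R : realType) : smooth (fun x : R => x).
Proof.
apply: (@smooth_coind _ (fun f => f = id \/ smooth f)); last by left.
move=> f [->|sf].
  split; first by move=> x; exact: derivable_id.
  right; rewrite (_ : _^`()%classic = fun _ : R => 1 : R); first exact: smooth_cst.
  by apply/funext => x; rewrite derive1E derive_id.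
by split; [exact: smooth_derivable|right; exact: smooth_derive1].
Qed.

Lemma smooth_gen_smooth (R : realType) (f : R -> R) : smooth_gen f -> smooth f.
Proof.
move: f; apply: smooth_coind => f.
elim=> {f} [f sf|f g Sf [df Sdf] Sg [dg Sdg]|f g Sf [df Sdf] Sg [dg Sdg]|
            f c d Sf [df Sdf]].
- split; first exact: smooth_derivable.
  by apply: SmoothBase; exact: smooth_derive1.
- have D (x : R) : is_derive x 1 (f \+ g) (f^`()%classic x + g^`()%classic x).
    by apply: is_deriveD; exact: derivable_is_derive1.
  split; first by move=> x; case: (D x).
  rewrite (_ : _^`()%classic = f^`()%classic \+ g^`()%classic); first exact: SmoothAdd.
  by apply/funext => x; exact: is_derive1E (D x).
- have D (x : R) : is_derive x 1 (f \* g) (f x * g^`()%classic x + g x * f^`()%classic x).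
    by apply: is_deriveM; exact: derivable_is_derive1.
  split; first by move=> x; case: (D x).
  rewrite (_ : _^`()%classic = (f \* g^`()%classic) \+ (g \* f^`()%classic)).
    by apply: SmoothAdd; apply: SmoothMul.
  by apply/funext => x; exact: is_derive1E (D x).
- have D (x : R) : is_derive x 1 (fun x => f (c * x + d)) (f^`()%classic (c * x + d) * c).
    by apply: is_derive_affine; exact: derivable_is_derive1.
  split; first by move=> x; case: (D x).
  rewrite (_ : _^`()%classic = (fun x => f^`()%classic (c * x + d)) \* (fun _ => c)).
    by apply: SmoothMul; [exact: SmoothAffine|
      apply: SmoothBase; exact: smooth_cst].
  by apply/funext => x; exact: is_derive1E (D x).
Qed.

Lemma smoothD (R : realType) (f g : R -> R) :
  smooth f -> smooth g -> smooth (f \+ g).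
Proof. by move=> sf sg; apply/smooth_gen_smooth/SmoothAdd; exact: SmoothBase. Qed.

Lemma smoothM (R : realType) (f g : R -> R) :
  smooth f -> smooth g -> smooth (f \* g).
Proof. by move=> sf sg; apply/smooth_gen_smooth/SmoothMul; exact: SmoothBase. Qed.

Lemma smooth_affine (R : realType) (f : R -> R) (c d : R) :
  smooth f -> smooth (fun x => f (c * x + d)).
Proof. by move=> sf; apply/smooth_gen_smooth/SmoothAffine; exact: SmoothBase. Qed.

(** * A bump function *)

Lemma exprn_le_fact_expR (R : realType) (n : nat) (t : R) :
  0 <= t -> t ^+ n <= n`!%:R * expR t.
Proof.
move=> t0; case: n => [|n].
  by rewrite expr0 fact0 mul1r -expR0 ler_expR.
rewrite mulrC -ler_pdivrMr ?ltr0n ?fact_gt0//.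
by apply: le_trans (expR_ge1Dxn n t0); rewrite lerDr.
Qed.

Lemma horner_le_expR (R : realType) (p : {poly R}) : exists2 C, 0 <= C &
  forall t, 0 <= t -> `|p.[t]| <= C * expR t.
Proof.
exists (\sum_(i < size p) `|p`_i| * i`!%:R).
  by apply: sumr_ge0 => i _; exact: mulr_ge0.
move=> t t0; rewrite horner_coef; apply: le_trans (ler_norm_sum _ _ _) _.
rewrite mulr_suml; apply: ler_sum => i _.
rewrite normrM -mulrA ler_wpM2l// normrX ger0_norm//.
exact: exprn_le_fact_expR.
Qed.

(** The functions p(1/x) exp(-1/x), extended by 0, are taken for all
    polynomials p together because this family is stable under derivation. *)
Definition flat (R : realType) (p : {poly R}) (x : R) : R :=
  if 0 < x then p.[x^-1] * expR (- x^-1) else 0.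

(** With t = 1/x, this is the domination of polynomials by the exponential. *)
Lemma flat_bounded (R : realType) (p : {poly R}) : exists2 C, 0 <= C &
  forall x, `|flat p x| <= C.
Proof.
have [C C0 HC] := horner_le_expR p; exists C => // x; rewrite /flat.
case: ifPn => [x0|_]; last by rewrite normr0.
rewrite normrM (ger0_norm (expR_ge0 _)) expRN ler_pdivrMr ?expR_gt0//.
by apply: HC; rewrite invr_ge0 ltW.
Qed.

(** Away from 0 this is a computation with 1/x. At 0 the function is quadratically
    small, since dividing it by x ^ 2 gives another function of the family,
    which is bounded. *)
Lemma is_derive_flat (R : realType) (p : {poly R}) (x : R) :
  is_derive x 1 (flat p) (flat ('X^2 * (p - p^`())) x).
Proof.
have [x0|x0|->] := ltgtP x 0.
- rewrite /flat ltNge (ltW x0)/=.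
  have : is_derive x 1 (fun _ : R => 0 : R) 0 by exact: is_derive_cst.
  apply: near_eq_is_derive.
  near=> y; rewrite ltNge (_ : y <= 0)//; apply: ltW.
  by near: y; exact: lt_nbhsl.
- have xn0 : x != 0 by rewrite gt_eqF.
  have I : is_derive x 1 (fun y : R => y^-1) (- x ^- 2).
    have := @is_deriveV R id x 1 1 xn0 (is_derive_id _ _).
    by rewrite /GRing.scale/= mulr1.
  have D : is_derive x 1 (fun y => p.[y^-1] * expR (- y^-1))
      (flat ('X^2 * (p - p^`())) x).
    have P : is_derive x^-1 1 (horner p) (p^`()).[x^-1].
      by rewrite derivE; apply/derivable_is_derive1/derivable_horner.
    have P' := @is_derive1_comp _ _ _ _ _ _ P I.
    have E' := @is_derive1_comp _ expR (fun y : R => - y^-1) x _ _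
      (is_derive_expR _) (is_deriveN I).
    have := is_deriveM P' E'; rewrite /GRing.scale/= => H.
    apply: is_derive_eq; rewrite /flat x0 !hornerE/= opprK exprVn; ring.
  apply: near_eq_is_derive D.
  near=> y; rewrite /flat (_ : 0 < y)//.
  by near: y; exact: lt_nbhsr.
- rewrite {2}/flat ltxx; apply/is_derive_epsP => e e0.
  have [C C0 HC] := flat_bounded ('X^2 * p).
  (* adding 1 keeps the denominator positive when C = 0 *)
  exists (e / (C + 1)); first by apply: divr_gt0 => //; lra.
  move=> h; rewrite ltr_pdivlMr; last by lra.
  move=> hd; rewrite add0r mul0r subr0 {2}/flat ltxx subr0.
  have -> : flat p h = h ^+ 2 * flat ('X^2 * p) h.
    rewrite /flat; case: ifPn => [h0|_]; last by rewrite mulr0.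
    by rewrite !hornerE/=; field; rewrite gt_eqF.
  rewrite normrM normrX expr2 -mulrA mulrC ler_wpM2r//.
  apply: le_trans (ltW hd); rewrite ler_wpM2l//.
  by apply: le_trans (HC h) _; lra.
Unshelve. all: by end_near. Qed.

Lemma smooth_flat (R : realType) (p : {poly R}) : smooth (flat p).
Proof.
apply: (@smooth_coind _ (fun f => exists p, f = flat p)); last by exists p.
move=> f [{}p ->]; split; first by move=> x; case: (is_derive_flat p x).
eexists; apply/funext => x; exact: is_derive1E (is_derive_flat p x).
Qed.

Definition test_fun (R : realType) (a b : R) (f : R -> R) : Prop :=
  smooth f /\ forall x, x \notin `[a, b] -> f x = 0.

Lemma bump_exists (R : realType) (a b : R) : a < b ->
  exists2 f, test_fun a b f & exists x, f x != 0.
Proof.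
move=> ab; exists (fun x => flat 1 (1 * x + - a) * flat 1 (-1 * x + b)).
  split.
    by apply: (@smoothM _ (fun x => _ (1 * x + - a)) (fun x => _ (-1 * x + b)));
      apply/smooth_affine/smooth_flat.
  move=> x; rewrite in_itv/= negb_and -!ltNge /flat => /orP[xa|bx].
    by rewrite ifF ?mul0r//; apply/negbTE; rewrite -leNgt; lra.
  by rewrite mulrC ifF ?mul0r//; apply/negbTE; rewrite -leNgt; lra.
exists ((a + b) / 2); rewrite /flat !ifT; [|lra|lra].
by rewrite !hornerE/= mulr1; apply: mulf_neq0; rewrite gt_eqF// expR_gt0.
Qed.

(** * Limits of smooth functions *)

Lemma cvg_half_powers (R : realType) (c : R) :
  (fun j => c / 2 ^+ j) @ \oo --> (0 : R).
Proof.
rewrite (_ : (fun _ => _) = geometric c 2^-1).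
  by apply: cvg_geometric; rewrite ger0_norm; lra.
by apply/funext => j; rewrite /geometric/= exprVn.
Qed.

Lemma cvg_of_geometric (R : realType) (u : nat -> R) (l c : R) :
  (forall j, `|l - u j| <= c / 2 ^+ j) -> u @ \oo --> l.
Proof.
move=> Hu; apply/cvgrPdist_le => e e0.
have /cvgrPdist_le/(_ e e0) := cvg_half_powers c; apply: filterS => j.
rewrite sub0r normrN => H.
by apply: le_trans (Hu j) _; apply: le_trans H; exact: ler_norm.
Qed.

(** The intervals of centre u j and radius c / 2 ^ j are nested, so the supremum
    of their left ends lies in all of them. *)
Lemma geometric_limit (R : realType) (u : nat -> R) (c : R) (i : nat) :
  0 <= c -> (forall j, (i <= j)%N -> `|u j.+1 - u j| <= c / 2 ^+ j.+1) ->
  exists l, forall j, (i <= j)%N -> `|l - u j| <= c / 2 ^+ j.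
Proof.
move=> c0 Hu; pose r j : R := c / 2 ^+ j.
have r0 j : 0 <= r j by rewrite divr_ge0// exprn_ge0.
have rS j : r j = 2 * r j.+1.
  by rewrite /r exprS; field; rewrite expf_neq0// pnatr_eq0.
have near_mono j p : (i <= j)%N ->
    u j - r j <= u (j + p)%N - r (j + p)%N /\
    u (j + p)%N + r (j + p)%N <= u j + r j.
  move=> ij; elim: p => [|p [IH1 IH2]]; first by rewrite addn0 !lexx.
  have := Hu (j + p)%N (leq_trans ij (leq_addr _ _)).
  rewrite -/(r _) addnS ler_norml => /andP[]; have := rS (j + p)%N.
  by move=> *; split; lra.
have vw m j : (i <= m)%N -> (i <= j)%N -> u m - r m <= u j + r j.
  move=> im ij; have rj := r0 j; have rm := r0 m; case: (leqP m j) => mj.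
    have := (near_mono m (j - m)%N im).1; rewrite subnKC// => ?; lra.
  have := (near_mono j (m - j)%N ij).2; rewrite subnKC ?(ltnW mj)// => ?; lra.
pose V := [set u m - r m | m in [set m | (i <= m)%N]].
have Vi : V (u i - r i) by exists i => /=.
have ub j : (i <= j)%N -> ubound V (u j + r j).
  by move=> ij _ [m /= im <-]; exact: vw.
exists (sup V) => j ij; rewrite ler_distl; apply/andP; split.
- apply: ub_le_sup; first by exists (u j + r j); exact: ub.
  by exists j.
- by apply: ge_sup; [exists (u i - r i)|exact: ub].
Qed.

Lemma lipschitz_of_derive_bound (R : realType) (f df : R -> R) (M : R) :
  (forall x : R, is_derive x 1 f (df x)) -> (forall x, `|df x| <= M) ->
  forall x y, `|f y - f x| <= M * `|y - x|.
Proof.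
move=> Df HM x y.
wlog xy : x y / x <= y => [H|].
  case/orP: (le_total x y) => [/H//|/H]; by rewrite distrC [`|x - y|]distrC.
have cf : {within `[x, y], continuous f}.
  apply: continuous_subspaceT; apply: derivable_continuous => z.
  by case: (Df z).
have [z _ ->] := MVT_segment xy (fun z _ => Df z) cf.
by rewrite normrM ler_wpM2r.
Qed.

(** Two late approximants have uniformly close derivatives, so by the mean value
    theorem their difference is Lipschitz with a small constant. This bound
    survives the passage to the limit in one of them, whence H and h J have
    nearly the same increments. *)
Lemma is_derive_uniform_limit (R : realType) (h d : nat -> R -> R)
    (H D : R -> R) (eps : nat -> R) :
  eps @ \oo --> 0 ->
  (\forall j \near \oo, forall x : R, is_derive x 1 (h j) (d j x)) ->
  (\forall j \near \oo, forall x, `|H x - h j x| <= eps j) ->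
  (\forall j \near \oo, forall x, `|D x - d j x| <= eps j) ->
  forall x : R, is_derive x 1 H (D x).
Proof.
move=> eps0 dh hH dD x.
have small e : 0 < e -> \forall j \near \oo, eps j <= e.
  move=> e0; have /cvgrPdist_le/(_ e e0) := eps0.
  by apply: filterS => j; rewrite sub0r normrN; apply: le_trans; exact: ler_norm.
apply/is_derive_epsP => e e0; have e4 : 0 < e / 4 by lra.
have all_j : \forall j \near \oo, [/\ eps j <= e / 4,
    forall x : R, is_derive x 1 (h j) (d j x), forall x, `|H x - h j x| <= eps j &
    forall x, `|D x - d j x| <= eps j].
  by near=> j; split; near: j => //; exact: small.
have [J _ HJ] := all_j.
have [eJ dJ hJ DJ] := HJ J (leqnn J).
have lip y z : `|(H z - h J z) - (H y - h J y)| <= e / 2 * `|z - y|.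
  apply/ler_addgt0Pr => r r0; have r2 : 0 < r / 2 by lra.
  have [m [Jm em]] : exists m, (J <= m)%N /\ eps m <= r / 2.
    near \oo => m; exists m; split; near: m; first exact: nbhs_infty_ge.
    exact: small.
  have [em4 dm hm Dm] := HJ m Jm.
  have Dmj (w : R) : is_derive w 1 (h m - h J) (d m w - d J w) by exact: is_deriveB.
  have Bmj w : `|d m w - d J w| <= e / 2.
    move: (DJ w) (Dm w); rewrite !ler_norml => /andP[? ?] /andP[? ?].
    by apply/andP; split; lra.
  have := lipschitz_of_derive_bound Dmj Bmj y z.
  rewrite !fctE; move: (hm y) (hm z).
  set t := e / 2 * _; rewrite !ler_norml => /andP[? ?] /andP[? ?] /andP[? ?].
  by apply/andP; split; lra.
have [r r0 Hr] := (is_derive_epsP _ _ _).1 (dJ x) _ e4.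
exists r => // t tr; have := Hr t tr; have := lip x (x + t).
have -> : x + t - x = t by ring.
have : `|D x * t - d J x * t| <= e / 4 * `|t|.
  by rewrite -mulrBl normrM ler_wpM2r//; apply: le_trans (DJ x) _.
have -> : e * `|t| = e / 4 * `|t| + e / 2 * `|t| + e / 4 * `|t| by field.
set T := e / 4 * _; set T' := e / 2 * _.
rewrite !ler_norml => /andP[? ?] /andP[? ?] /andP[? ?].
by apply/andP; split; lra.
Unshelve. all: by end_near. Qed.

Lemma derive1n_lincomb (R : realType) (f g : R -> R) (c : R) :
  smooth f -> smooth g -> forall n x,
  (f \+ (fun x => c * g x))^`(n)%classic x =
  f^`(n)%classic x + c * g^`(n)%classic x.
Proof.
move=> sf sg; elim=> [//|n IH] x; rewrite !derive1nS.
rewrite (_ : _^`(n)%classic =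
  (fun x => f^`(n)%classic x + c * g^`(n)%classic x)); last exact/funext.
apply: is_derive1E; apply: is_deriveD.
  by apply: derivable_is_derive1; exact: sf.
by apply: is_deriveZ; apply: derivable_is_derive1; exact: sg.
Qed.

(** Each derivative converges uniformly, although only from the rank equal to
    its order on. Hence only finitely many derivatives need to be controlled
    at each step of a construction by successive corrections. *)
Lemma smooth_geometric_limit (R : realType) (F : nat -> R -> R) (c : R) :
  0 <= c -> (forall j, smooth (F j)) ->
  (forall j i x, (i <= j)%N ->
    `|(F j.+1)^`(i)%classic x - (F j)^`(i)%classic x| <= c / 2 ^+ j.+1) ->
  exists2 f, smooth f & forall j x, `|f x - F j x| <= c / 2 ^+ j.
Proof.
move=> c0 sF HF.
have /choice[G HG] (p : nat * R) : exists l, forall j, (p.1 <= j)%N ->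
    `|l - (F j)^`(p.1)%classic p.2| <= c / 2 ^+ j.
  by apply: geometric_limit => // j; exact: HF.
have DG i : forall x : R, is_derive x 1 (fun x => G (i, x)) (G (i.+1, x)).
  apply: (@is_derive_uniform_limit _ (fun j => (F j)^`(i)%classic)
    (fun j => (F j)^`(i.+1)%classic) _ (fun x => G (i.+1, x)) _
    (cvg_half_powers c)).
  - near=> j => x; rewrite derive1nS; apply: derivable_is_derive1; exact: sF.
  - near=> j => x; apply: (HG (i, x)) => /=; near: j; exact: nbhs_infty_ge.
  - near=> j => x; apply: (HG (i.+1, x)) => /=; near: j; exact: nbhs_infty_ge.
exists (fun x => G (0%N, x)); last by move=> j x; exact: (HG (0%N, x)).
apply: (@smooth_coind _ (fun f => exists i, f = fun x => G (i, x)));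
  last by exists 0%N.
move=> f [i ->]; split; first by move=> x; case: (DG i x).
by exists i.+1; apply/funext => x; exact: is_derive1E (DG i x).
Unshelve. all: by end_near. Qed.

(** * Smooth functions supported in a segment *)

Lemma test_fun_lincomb (R : realType) (a b : R) (f g : R -> R) (c : R) :
  test_fun a b f -> test_fun a b g ->
  test_fun a b (f \+ (fun x => c * g x)).
Proof.
move=> [sf f0] [sg g0]; split.
  apply: (@smoothD _ f (fun x => c * g x) sf).
  exact: (@smoothM _ (fun=> c) g (@smooth_cst R c) sg).
by move=> x xab; rewrite /= f0// g0// mulr0 addr0.
Qed.

Lemma test_fun_mul (R : realType) (a b : R) (f g : R -> R) :
  smooth g -> test_fun a b f -> test_fun a b (g \* f).
Proof.
move=> sg [sf f0]; split; first exact: smoothM.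
by move=> x xab; rewrite /= f0// mulr0.
Qed.

Lemma test_fun_derive1 (R : realType) (a b : R) (f : R -> R) :
  test_fun a b f -> test_fun a b f^`()%classic.
Proof.
move=> [sf f0]; split; first exact: smooth_derive1.
move=> x xab; apply: is_derive1E.
have : is_derive x 1 (fun _ : R => 0 : R) 0 by exact: is_derive_cst.
apply: near_eq_is_derive.
move: xab; rewrite in_itv/= negb_and -!ltNge => /orP[xa|bx].
  near=> y; rewrite f0// in_itv/= negb_and -!ltNge (_ : y < a)//.
  by near: y; exact: lt_nbhsl.
near=> y; rewrite f0// in_itv/= negb_and -!ltNge (_ : b < y) ?orbT//.
by near: y; exact: lt_nbhsr.
Unshelve. all: by end_near. Qed.

Lemma test_fun_derive1n (R : realType) (a b : R) (f : R -> R) (n : nat) :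
  test_fun a b f -> test_fun a b f^`(n)%classic.
Proof. by move=> tf; elim: n => [//|n]; exact: test_fun_derive1. Qed.

(** Continuity extends the vanishing outside the segment to its ends, which kills
    the boundary terms of integrations by parts. *)
Lemma test_fun_endpoints (R : realType) (a b : R) (f : R -> R) :
  test_fun a b f -> f a = 0 /\ f b = 0.
Proof.
move=> [sf f0]; have cf := derivable_continuous (smooth_derivable sf).
have near_neq0 x : f x != 0 -> \forall y \near x, f y != 0.
  by move=> fx; exact: (cvgr_neq0 (f x) (cf x)) fx.
split; apply/eqP/negPn/negP => /near_neq0 H.
  have near_zero : \forall y \near a^'-, f y != 0 /\ y < a.
    near=> y; split; near: y; first exact: cvg_within.
    exact: nbhs_left_lt.
  have [y [fy ya]] := @filter_ex _ _ (at_left_proper_filter a) _ near_zero.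
  by move: fy; rewrite f0 ?eqxx// in_itv/= negb_and -ltNge ya.
have near_zero : \forall y \near b^'+, f y != 0 /\ b < y.
  near=> y; split; near: y; first exact: cvg_within.
  exact: nbhs_right_gt.
have [y [fy yb]] := @filter_ex _ _ (at_right_proper_filter b) _ near_zero.
by move: fy; rewrite f0 ?eqxx// in_itv/= negb_and -!ltNge yb orbT.
Unshelve. all: by end_near. Qed.

Lemma test_fun_bounded (R : realType) (a b : R) (f : R -> R) : a <= b ->
  test_fun a b f -> exists2 C, 0 <= C & forall x, `|f x| <= C.
Proof.
move=> ab [sf f0].
have cf : continuous f by exact: derivable_continuous (smooth_derivable sf).
have cn : {within `[a, b], continuous (fun x => `|f x|)}.
  apply: continuous_subspaceT => x.
  exact: (@continuous_comp _ _ _ f Num.norm x (cf x) (@norm_continuous _ _ _)).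
have [c _ Hc] := EVT_max ab cn.
exists `|f c| => // x; have [/Hc//|/f0 ->] := boolP (x \in `[a, b]).
by rewrite normr0.
Qed.

(** * An operator acting diagonally on moments *)

(** The derivation (x f)' is formally adjoint to - x d/dx, for which the monomial
    x ^ m is an eigenvector with eigenvalue - m. *)
Definition dilation (R : realType) (f : R -> R) : R -> R :=
  (fun x => x * f x)^`()%classic.

Definition kill_moment (R : realType) (k : nat) (f : R -> R) : R -> R :=
  f \+ (fun x => k%:R^-1 * dilation f x).

Lemma smooth_exprn (R : realType) (n : nat) : smooth (fun x : R => x ^+ n).
Proof.
elim: n => [|n IH]; first exact: smooth_cst.
rewrite (_ : (fun _ => _) = id \* (fun x => x ^+ n)).
  exact: (@smoothM _ _ _ (@smooth_id R) IH).
by apply/funext => x; rewrite exprS.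
Qed.

Lemma is_derive_exprn (R : realType) (n : nat) (x : R) :
  is_derive x 1 (fun y : R => y ^+ n) (n%:R * x ^+ n.-1).
Proof.
have := derivable_is_derive1 (@derivable_horner R 'X^n x).
rewrite -derivE derivXn hornerMn hornerXn -mulr_natl.
by rewrite (_ : horner 'X^n = fun y => y ^+ n)//; apply/funext => y; rewrite hornerXn.
Qed.

Lemma integrable_continuous (R : realType) (a b : R) (f : R -> R) :
  continuous f -> (@lebesgue_measure R).-integrable `[a, b] (EFin \o f).
Proof.
move=> cf; apply: continuous_compact_integrable; first exact: segment_compact.
exact: continuous_subspaceT.
Qed.

Lemma test_fun_dilation (R : realType) (a b : R) (f : R -> R) :
  test_fun a b f -> test_fun a b (dilation f).
Proof.
move=> tf; apply: test_fun_derive1.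
exact: (@test_fun_mul _ a b f (fun x => x) (@smooth_id R) tf).
Qed.

Lemma test_fun_kill_moment (R : realType) (a b : R) (k : nat) (f : R -> R) :
  test_fun a b f -> test_fun a b (kill_moment k f).
Proof.
by move=> tf; apply: test_fun_lincomb => //; exact: test_fun_dilation.
Qed.

Lemma integral_derive1_test_fun (R : realType) (a b : R) (f : R -> R) :
  a < b -> test_fun a b f ->
  (\int[@lebesgue_measure R]_(x in `[a, b]) (f^`()%classic x)%:E = 0)%E.
Proof.
move=> ab tf; have [sf _] := tf; have [fa fb] := test_fun_endpoints tf.
have df := smooth_derivable sf; have cf := derivable_continuous df.
have cdf : {within `[a, b], continuous f^`()%classic}.
  apply: continuous_subspaceT; apply: derivable_continuous.
  exact: smooth_derivable (smooth_derive1 sf).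
have bf : derivable_oo_LRcontinuous f a b.
  split; first by move=> x _; exact: df.
    exact: cvg_at_right_filter (cf a).
  exact: cvg_at_left_filter (cf b).
by rewrite (continuous_FTC2 ab cdf bf (fun _ _ => erefl)) fa fb subee.
Qed.

(** Integrating x ^ m (x f)' by parts gives - m times the moment of order m of f:
    the operator acts diagonally on moments. In particular it annihilates the
    moment of order k when k > 0, and never revives one that vanishes. *)
Lemma moment_kill_moment (R : realType) (a b : R) (k m : nat) (f : R -> R) :
  a < b -> test_fun a b f ->
  moment a b (kill_moment k f) m =
  ((1 - m%:R / k%:R)%:E * moment a b f m)%E.
Proof.
move=> ab tf; have [sf _] := tf.
have sxf : smooth (fun x => x * f x) by exact: (smoothM (@smooth_id R) sf).
pose G x := x ^+ m * (x * f x).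
have tG : test_fun a b G.
  apply: (@test_fun_mul _ a b (fun x => x * f x) (fun x => x ^+ m)).
    exact: smooth_exprn.
  exact: (@test_fun_mul _ a b f (fun x => x) (@smooth_id R) tf).
have dG x : G^`()%classic x = x ^+ m * dilation f x + m%:R * (f x * x ^+ m).
  apply: is_derive1E.
  have dxf : is_derive x 1 (fun x => x * f x) (dilation f x).
    by apply: derivable_is_derive1; exact: smooth_derivable.
  have := is_deriveM (is_derive_exprn m x) dxf.
  rewrite /GRing.scale/= => H.
  apply: is_derive_eq; congr (_ + _); case: m {G tG H} => [|m].
    by rewrite !mul0r mulr0.
  by rewrite exprS; ring.
have mI : measurable (`[a, b] : set (measurableTypeR R)) by [].
have If : (@lebesgue_measure R).-integrable `[a, b]
    (EFin \o (fun x => f x * x ^+ m)).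
  apply/integrable_continuous/derivable_continuous/smooth_derivable.
  exact: (smoothM sf (@smooth_exprn R m)).
have IG : (@lebesgue_measure R).-integrable `[a, b] (EFin \o G^`()%classic).
  apply/integrable_continuous/derivable_continuous/smooth_derivable.
  exact: smooth_derive1 tG.1.
rewrite /moment.
under eq_integral => x _.
  rewrite (_ : kill_moment k f x * x ^+ m =
    (1 - m%:R / k%:R) * (f x * x ^+ m) + k%:R^-1 * G^`()%classic x); last first.
    by rewrite dG /kill_moment/=; ring.
  rewrite EFinD !EFinM.
  over.
rewrite integralD//.
- rewrite integralZl// integralZl//.
  by rewrite integral_derive1_test_fun// mule0 adde0.
- exact: integrableZl.
- exact: integrableZl.
Qed.

(** On the segment the approximants are dominated by `|f| + c, so their moments
    converge. *)
Lemma moment_limit_eq0 (R : realType) (a b c : R) (m : nat)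
    (F : nat -> R -> R) (f : R -> R) (J : nat) :
  (forall j, continuous (F j)) -> continuous f ->
  (forall j x, `|f x - F j x| <= c / 2 ^+ j) ->
  (forall j, (J <= j)%N -> moment a b (F j) m = 0%E) ->
  moment a b f m = 0%E.
Proof.
move=> cF cf fF F0.
have cm (g : R -> R) : continuous g -> continuous (fun x => g x * x ^+ m).
  move=> cg x; apply: (@continuousM _ _ g (fun x => x ^+ m)); first exact: cg.
  exact: exprn_continuous.
have mI : measurable (`[a, b] : set (measurableTypeR R)) by [].
have mg (g : R -> R) (cg : continuous g) := measurable_int _
  (integrable_continuous a b (cm _ cg)).
have c0 : 0 <= c.
  by have := le_trans (normr_ge0 _) (fF 0%N 0); rewrite expr0 divr1.
have cvgF x : F ^~ x @ \oo --> f x := cvg_of_geometric (fF^~ x).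
pose g x := (`|f x| + c) * `|x ^+ m|.
have ig : (@lebesgue_measure R).-integrable `[a, b] (EFin \o g).
  apply: integrable_continuous => x; rewrite /g; apply: cvgM.
    by apply: cvgD; [apply: cvg_norm; exact: cf|exact: cvg_cst].
  by apply: cvg_norm; exact: exprn_continuous.
have cvg_integrand x : (EFin \o (fun x => F j x * x ^+ m)) x @[j --> \oo]
    --> (EFin \o (fun x => f x * x ^+ m)) x.
  by apply: cvg_EFin; [near=> j|apply: cvgMl; exact: cvgF].
have bounded j x : (`|(F j x * x ^+ m)%R%:E| <= (g x)%:E)%E.
  rewrite lee_fin normrM ler_wpM2r// -[F j x](subKr (f x)).
  rewrite (le_trans (ler_normB _ _))// lerD2l; apply: le_trans (fF j x) _.
  by rewrite ler_pdivrMr ?exprn_gt0// ler_peMr// exprn_ege1// ler1n.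
have [||_ _ H] := dominated_convergence mI (fun j => mg _ (cF j)) (mg _ cf)
  _ ig _.
- by apply: aeW => x _; exact: cvg_integrand.
- by apply: aeW => x j _; exact: bounded.
have H0 : moment a b (F j) m @[j --> \oo] --> 0%E.
  apply: cvg_near_cst; near=> j; apply: F0; near: j; exact: nbhs_infty_ge.
exact: (cvg_unique _ H H0).
Unshelve. all: by end_near. Qed.
(** * A convergent product of moment-killing operators *)

Lemma test_fun_derivatives_bounded (R : realType) (a b : R) (u : R -> R)
    (j : nat) : a <= b -> test_fun a b u ->
  exists2 C, 0 <= C & forall i x, (i <= j)%N -> `|u^`(i)%classic x| <= C.
Proof.
move=> ab tu; elim: j => [|j [C C0 HC]].
  have [C C0 HC] := test_fun_bounded ab tu.
  by exists C => // i x; rewrite leqn0 => /eqP ->; exact: HC.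
have [C' C'0 HC'] := test_fun_bounded ab (test_fun_derive1n j.+1 tu).
exists (C + C') => [|i x]; first exact: addr_ge0.
rewrite leq_eqVlt ltnS => /orP[/eqP ->|ij].
  by rewrite (le_trans (HC' x))// lerDr.
by rewrite (le_trans (HC i x ij))// lerDl.
Qed.

(** The derivatives of order at most j of a test function are bounded, and the
    division by k makes all of them small. *)
Lemma large_divisor (R : realType) (a b : R) (u : R -> R) (j N : nat) (e : R) :
  a <= b -> test_fun a b u -> 0 < e ->
  exists2 k, (N < k)%N &
    forall i x, (i <= j)%N -> `|k%:R^-1 * u^`(i)%classic x| <= e.
Proof.
move=> ab tu e0; have [C C0 HC] := test_fun_derivatives_bounded j ab tu.
exists (maxn N.+1 (Num.bound (C / e))) => [|i x ij]; first exact: leq_maxl.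
set k := maxn _ _; have k0 : 0 < k%:R :> R by rewrite ltr0n leq_max.
rewrite normrM ger0_norm; last by rewrite invr_ge0 ltW.
rewrite mulrC ler_pdivrMr//.
apply: le_trans (HC i x ij) _; rewrite mulrC -ler_pdivrMr//.
apply: le_trans (ltW (archi_boundP (divr_ge0 C0 (ltW e0)))) _.
by rewrite ler_nat leq_maxr.
Qed.

(** The correction at step j is 1 / k j times a test function already fixed when
    k j is chosen, so k j can be taken large enough to make it as small as
    wanted. *)
Lemma kill_moment_sequence (R : realType) (a b c : R) (g : R -> R) :
  a <= b -> 0 < c -> test_fun a b g ->
  exists (F : nat -> R -> R) (k : nat -> nat),
    [/\ F 0%N = g, forall j, F j.+1 = kill_moment (k j) (F j),
        forall j, test_fun a b (F j), forall j, (j < k j)%N &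
        forall j i x, (i <= j)%N ->
          `|(F j.+1)^`(i)%classic x - (F j)^`(i)%classic x| <= c / 2 ^+ j.+1].
Proof.
move=> ab c0 tg.
(* K chooses the divisor for a function f and a step j, packed as (f, j), before
   the sequence is defined by recursion *)
have /choice[K HK] (q : (R -> R) * nat) : exists k, test_fun a b q.1 ->
    (q.2 < k)%N /\ forall i x, (i <= q.2)%N ->
      `|k%:R^-1 * (dilation q.1)^`(i)%classic x| <= c / 2 ^+ q.2.+1.
  have [tq|ntq] := pselect (test_fun a b q.1); last by exists 0%N.
  have e0 : 0 < c / 2 ^+ q.2.+1 by rewrite divr_gt0// exprn_gt0.
  have [k Nk Hk] := large_divisor q.2 q.2 ab (test_fun_dilation tq) e0.
  by exists k.
pose F := fix F j := if j is j'.+1 then kill_moment (K (F j', j')) (F j') else g.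
have tF j : test_fun a b (F j).
  by elim: j => [//|j IH]; exact: test_fun_kill_moment.
exists F, (fun j => K (F j, j)); split.
- by [].
- by [].
- exact: tF.
- by move=> j; exact: (HK (F j, j) (tF j)).1.
- move=> j i x ij; rewrite -[F j.+1]/(kill_moment (K (F j, j)) (F j)).
  rewrite (derive1n_lincomb _ (tF j).1 (test_fun_dilation (tF j)).1).
  by rewrite addrC addKr; exact: (HK (F j, j) (tF j)).2.
Qed.

(** If nu vanishes on all measurable sets then so does its distribution function,
    whose derivative at x is f x. *)
Lemma nonzero_charge_continuous (R : realType)
    (nu : {charge set (measurableTypeR R) -> \bar R}) (f : R -> R) (x : R) :
  has_lebesgue_density nu f -> continuous f -> f x != 0 -> nonzero_charge nu.
Proof.
move=> [intf nuE] cf fx; apply: contrapT => nu0.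
have zero A : measurable A -> nu A = 0%E.
  by move=> mA; apply: contrapT => nA; apply: nu0; exists A => //; exact/eqP.
move/eqP: fx; apply.
have intfy : (@lebesgue_measure R).-integrable
    [set` Interval -oo%O (BRight (x + 1))] (EFin \o f).
  exact: integrableS intf.
have xx1 : x < x + 1 by rewrite ltrDl.
have [|_ <-] := continuous_FTC1 xx1 intfy _ (cf x); first by rewrite ltNyr.
rewrite (_ : (fun _ => _) = cst 0) ?derive1_cst//.
by apply/funext => y; rewrite /Rintegral -nuE ?zero.
Qed.

Lemma unbounded_infinite_set (A : set nat) :
  (forall n, exists2 k, (n < k)%N & A k) -> infinite_set A.
Proof.
move=> unbA /finite_seqP[s As]; have [k] := unbA (\max_(i <- s) i)%N.
rewrite As/= => + ks; rewrite ltnNge => /negP; apply.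
exact: (@leq_bigmax_seq nat s xpredT (fun i => i) k ks isT).
Qed.

Theorem theorem15 (R : realType) (a b : R) (a_gt0 : 0 < a) (a_lt_b : a < b) :
  exists (nu : {charge set (measurableTypeR R) -> \bar R}) (f : R -> R),
    [/\ smooth f,
        fun_support f `<=` `[a, b],
        has_lebesgue_density nu f,
        nonzero_charge nu &
        nu [set: R] = 0%E /\
        infinite_set [set k : nat | moment a b f k = 0%E]].
Proof.
have ab := ltW a_lt_b.
have [g tg [y gy]] := bump_exists a_lt_b.
have tg' := test_fun_derive1 tg.
have [x0 g'x0] : exists x0, g^`()%classic x0 != 0.
  apply: contrapT => g'0.
  have dg (x : R) : is_derive x 1 g 0.
    have := derivable_is_derive1 (@smooth_derivable _ _ tg.1 x).
    have [->//|g'x] := eqVneq (g^`()%classic x) 0.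
    by case: g'0; exists x.
  move: gy; rewrite (is_derive_0_is_cst y (a - 1) dg).
  by rewrite tg.2 ?eqxx// in_itv/= negb_and -ltNge ltrBlDr ltrDl ltr01.
(* all corrections together move the value at x0 by at most c, less than
   its initial size *)
pose c := `|g^`()%classic x0| / 2.
have c0 : 0 < c by rewrite divr_gt0 ?normr_gt0.
have [F [k [F0 FS tF jk FD]]] := kill_moment_sequence ab c0 tg'.
have [f sf fF] := smooth_geometric_limit (ltW c0) (fun j => (tF j).1) FD.
have cf : continuous f by exact: derivable_continuous (smooth_derivable sf).
have cF j : continuous (F j).
  exact: derivable_continuous (smooth_derivable (tF j).1).
have f0 x : x \notin `[a, b] -> f x = 0.
  move=> xab; have cvgf : F ^~ x @ \oo --> f x := cvg_of_geometric (fF^~ x).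
  apply: (cvg_unique _ cvgf) => //.
  by apply: cvg_near_cst; near=> j; exact: (tF j).2.
have momentF i m : moment a b (F i) m = 0%E ->
    forall j, (i <= j)%N -> moment a b (F j) m = 0%E.
  move=> Fi j /subnKC <-; elim: (j - i)%N => [|p IH]; first by rewrite addn0.
  by rewrite addnS FS moment_kill_moment// IH mule0.
have moment0 i m : moment a b (F i) m = 0%E -> moment a b f m = 0%E.
  by move=> Fi; exact: (moment_limit_eq0 cF cf fF (momentF i m Fi)).
have moment_f0 : moment a b f 0 = 0%E.
  (* F 0 is the derivative of a function vanishing at both ends *)
  apply: (moment0 0%N); rewrite F0 /moment.
  under eq_integral do rewrite expr0 mulr1.
  exact: integral_derive1_test_fun.
have fE : EFin \o f = (EFin \o f) \_ `[a, b].
  apply/funext => x; rewrite patchE; case: ifPn => // /negP xab.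
  by rewrite /= f0//; apply/negP => xab'; apply: xab; rewrite inE.
have intf : (@lebesgue_measure R).-integrable [set: R] (EFin \o f).
  by rewrite fE -integrable_mkcond//; exact: integrable_continuous.
pose nu : {charge set (measurableTypeR R) -> \bar R} := induced_charge intf.
have dens : has_lebesgue_density nu f by [].
exists nu, f; split => //.
- rewrite [X in _ `<=` X](closure_id _).1; last exact: itv_closed.
  apply: closureS => x /= fx; apply: contrapT => xab; move/eqP: fx; apply.
  by apply: f0; apply/negP.
- apply: (nonzero_charge_continuous (x := x0) dens cf).
  apply/eqP => fx0; have := fF 0%N x0.
  rewrite fx0 F0 sub0r normrN expr0 divr1 /c; have := normr_gt0 (g^`()%classic x0).
  by rewrite g'x0 => ? ?; lra.
- split.
    rewrite -moment_f0 /moment dens.2// integral_mkcond [RHS]integral_mkcond.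
    rewrite patch_setT; apply: eq_integral => x _.
    rewrite -[LHS]/((EFin \o f) x) fE !patchE; case: ifPn => // _.
    by rewrite /= expr0 mulr1.
  apply: unbounded_infinite_set => n; exists (k n); first exact: jk.
  apply: (moment0 n.+1); rewrite FS moment_kill_moment//.
  by rewrite divff ?subrr ?mul0e// pnatr_eq0 -lt0n (leq_ltn_trans _ (jk n)).
Unshelve. all: by end_near. Qed.
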